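(* For every $n\ge 1$, the rotundus polynomial $R_n$ is cyclically invariant: as polynomials in commuting indeterminates $a_1,\dots,a_n$, $$R_n(a_1,\dots,a_n)=R_n(a_n,a_1,\dots,a_{n-1}).$$
   Context: The continuant $K_n(a_1,\dots,a_n)$ is the determinant of the $n\times n$ tridiagonal matrix with diagonal entries $a_1,\dots,a_n$, all entries immediately above and below the diagonal equal to $1$, and all other entries $0$; by convention $K_0=1$ and $K_{-1}=0$. The rotundus is the polynomial $R_n(a_1,\dots,a_n):=K_n(a_1,\dots,a_n)-K_{n-2}(a_2,\dots,a_{n-1})$ (so $R_1(a_1)=a_1$ and $R_2(a_1,a_2)=a_1a_2-2$). *)

(* Defs.v *)
From mathcomp Require Import all_boot all_algebra.
From mathcomp Require Export mpoly.

Set Implicit Arguments.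
Unset Strict Implicit.
Unset Printing Implicit Defensive.

Import GRing.Theory.
Local Open Scope ring_scope.

(* The indeterminate a_(i+1) is 'X_i, with i : 'I_n counted from 0. *)
Definition continuant_mx (R : comNzRingType) (n : nat) : 'M[{mpoly R[n]}]_n :=
  \matrix_(i, j)
    if i == j then 'X_i
    else if (j == i.+1 :> nat) || (i == j.+1 :> nat) then 1
    else 0.

Definition continuant (R : comNzRingType) (n : nat) : {mpoly R[n]} :=
  \det (continuant_mx R n).

(* K_(n-2)(a_2, ..., a_(n-1)) as a polynomial in a_1, ..., a_n: the i-th
   variable of K_m is replaced by the (i+1)-th of m+2 variables. The case n = 1
   is the convention K_(-1) = 0; the case n = 0 is a dummy value. *)
Definition inner_continuant (R : comNzRingType) (n : nat) : {mpoly R[n]} :=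
  match n with
  | m.+2 => continuant R m \mPo
              [tuple 'X_(lift ord0 (widen_ord (leqnSn m) i)) | i < m]
  | _ => 0
  end.

Definition rotundus (R : comNzRingType) (n : nat) : {mpoly R[n]} :=
  continuant R n - inner_continuant R n.

(* Main.v *)
(* Expanding the tridiagonal determinant at either end gives
   K_n(a_1, ..., a_n) = a_1 K_(n-1)(a_2, ..., a_n) - K_(n-2)(a_3, ..., a_n)
                      = a_n K_(n-1)(a_1, ..., a_(n-1)) - K_(n-2)(a_1, ..., a_(n-2)).
   Applying the second form to R_n(a_1, ..., a_n) and the first one to
   R_n(a_n, a_1, ..., a_(n-1)), both become
   a_n K_(n-1)(a_1, ..., a_(n-1)) - K_(n-2)(a_1, ..., a_(n-2))
     - K_(n-2)(a_2, ..., a_(n-1)). *)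
Require Import Defs.
From mathcomp Require Import all_boot all_algebra.
From mathcomp Require Import mpoly.
From mathcomp Require Import ring.
Import GRing.Theory.
Local Open Scope ring_scope.

(** Taking the entries from a sequence keeps continuants of all sizes in one ring, and dropping the
    first variable becomes composition with [S]. *)
Definition tridiag (A : comNzRingType) (a : nat -> A) (n : nat) : 'M[A]_n :=
  \matrix_(i, j)
    if i == j then a i
    else if (j == i.+1 :> nat) || (i == j.+1 :> nat) then 1
    else 0.

Definition tridet (A : comNzRingType) (a : nat -> A) (n : nat) : A :=
  \det (tridiag A a n).

Lemma tridiag_minor00 (A : comNzRingType) (a : nat -> A) (n : nat) :
  row' ord0 (col' ord0 (tridiag A a n.+1)) = tridiag A (a \o S) n.
Proof. by apply/matrixP => i j; rewrite !mxE (inj_eq lift_inj) !lift0 !eqSS. Qed.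

Lemma eq_tridet (A : comNzRingType) (a b : nat -> A) (n : nat) :
  (forall i, (i < n)%N -> a i = b i) -> tridet A a n = tridet A b n.
Proof.
move=> eq_ab; congr (\det _); apply/matrixP => i j; rewrite !mxE.
by case: ifP => // _; apply: eq_ab.
Qed.

Lemma tridet0 (A : comNzRingType) (a : nat -> A) : tridet A a 0%N = 1.
Proof. exact: det_mx00. Qed.

Lemma tridet1 (A : comNzRingType) (a : nat -> A) : tridet A a 1%N = a 0%N.
Proof. by rewrite /tridet det_mx11 mxE. Qed.

Lemma tridet_recl (A : comNzRingType) (a : nat -> A) (n : nat) :
  tridet A a n.+2 = a 0%N * tridet A (a \o S) n.+1 - tridet A (a \o S \o S) n.
Proof.
rewrite /tridet (expand_det_row _ ord0) 2!big_ord_recl big1 => [|j _]; last first.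
  by rewrite mxE mul0r.
rewrite addr0 !mxE /= mul1r; congr (_ * _ + _).
  by rewrite /cofactor addn0 expr0 mul1r tridiag_minor00.
rewrite /cofactor /= expr1 mulN1r; congr (- _).
(* The minor of the entry (0, 1) has first column (1, 0, ..., 0). *)
rewrite (expand_det_col _ ord0) big_ord_recl big1 => [|i _]; last first.
  by rewrite !mxE /= mul0r.
rewrite addr0 !mxE /= mul1r /cofactor expr0 mul1r.
congr (\det _); apply/matrixP => i j; rewrite !mxE.
(* Past index 0, skipping column 1 is the same shift as skipping column 0. *)
have -> : lift (lift ord0 ord0) (lift ord0 j) = lift ord0 (lift ord0 j) :> 'I_n.+2.
  by apply: val_inj.
by rewrite !(inj_eq lift_inj) !lift0 !eqSS.
Qed.

(** By induction from [tridet_recl]: expand at the left, apply the recurrence to both smaller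
    continuants, and regroup by left expansions. *)
Lemma tridet_recr (A : comNzRingType) (a : nat -> A) (n : nat) :
  tridet A a n.+2 = a n.+1 * tridet A a n.+1 - tridet A a n.
Proof.
elim/ltn_ind: n a => -[|[|n]] IHn a.
- by rewrite tridet_recl !tridet0 !tridet1 mulrC.
- by rewrite !tridet_recl !tridet1 !tridet0 /=; ring.
- rewrite tridet_recl (IHn n.+1) // (IHn n _ (a \o S \o S)) // (tridet_recl _ a n.+1).
  by rewrite (tridet_recl _ a n) /=; ring.
Qed.

Lemma rmorph_tridet (A B : comNzRingType) (f : {rmorphism A -> B})
    (a : nat -> A) (n : nat) :
  f (tridet A a n) = tridet B (f \o a) n.
Proof.
rewrite /tridet -det_map_mx; congr (\det _); apply/matrixP => i j.
by rewrite !mxE; do 2?case: ifP => _ //; rewrite ?rmorph0 ?rmorph1.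
Qed.

Lemma tridet_rot (A : comNzRingType) (a b : nat -> A) (n : nat) :
  b 0%N = a n.+1 -> (forall i, (i <= n)%N -> b i.+1 = a i) ->
  tridet A a n.+2 - tridet A (a \o S) n = tridet A b n.+2 - tridet A (b \o S) n.
Proof.
move=> b0 bS; rewrite tridet_recr tridet_recl b0.
rewrite (eq_tridet _ (b \o S) a n.+1) => [|i]; last exact: bS.
rewrite (eq_tridet _ (b \o S \o S) (a \o S) n) => [|i]; last exact: bS.
rewrite (eq_tridet _ (b \o S) a n) => [|i /ltnW]; last exact: bS.
(* The inner continuant of each side is the last term in the expansion of the other. *)
by rewrite addrAC.
Qed.

(** Substitution is a ring morphism, so it commutes with the determinant; the default 0 of [nth] is
    never read. *)
Lemma comp_continuant (R : comNzRingType) (n k : nat)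
    (t : n.-tuple {mpoly R[k]}) :
  continuant R n \mPo t = tridet _ (nth 0 t) n.
Proof.
rewrite /continuant /tridet -det_map_mx; congr (\det _); apply/matrixP => i j.
rewrite !mxE; case: ifP => _; first exact: comp_mpolyXU.
by case: ifP => _; rewrite ?rmorph0 ?rmorph1.
Qed.

Lemma comp_inner_continuant (R : comNzRingType) (n k : nat)
    (t : n.+2.-tuple {mpoly R[k]}) :
  inner_continuant R n.+2 \mPo t = tridet _ (nth 0 t \o S) n.
Proof.
rewrite /= comp_continuant rmorph_tridet; apply: eq_tridet => i lt_in /=.
by rewrite (nth_mktuple _ 0 (Ordinal lt_in)) comp_mpolyXU lift0.
Qed.

Lemma comp_rotundus (R : comNzRingType) (n k : nat)
    (t : n.+2.-tuple {mpoly R[k]}) :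
  rotundus R n.+2 \mPo t = tridet _ (nth 0 t) n.+2 - tridet _ (nth 0 t \o S) n.
Proof. by rewrite comp_mpolyB comp_continuant comp_inner_continuant. Qed.

Theorem proposition1 (R : comNzRingType) (n : nat) (hn : (1 <= n)%N) :
  rotundus R n = rotundus R n \mPo [tuple 'X_(ord_pred i) | i < n].
Proof.
(* Inserting the identity substitution lets [comp_rotundus] treat both sides alike; for one variable
   the two substitutions coincide. *)
rewrite -[LHS]comp_mpoly_id; case: n hn => [|[|n]] // _.
  congr (_ \mPo _); apply: eq_mktuple => i.
  by rewrite [i]ord1 [ord_pred _]ord1.
rewrite !comp_rotundus; apply: tridet_rot => [|i le_in].
  (* Here [ord_pred] wraps around from 0 to the last index. *)
  rewrite (nth_mktuple _ 0 ord0) (nth_mktuple _ 0 ord_max).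
  by congr 'X_ _; apply: val_inj; rewrite /= modn_small.
have lt_i : (i.+1 < n.+2)%N by [].
rewrite (nth_mktuple _ 0 (Ordinal lt_i)) (nth_mktuple _ 0 (Ordinal (ltnW lt_i))).
congr 'X_ _; apply: val_inj => /=.
by rewrite modnDr modn_small // ltnW.
Qed.
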